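(* Let $(X,\mathcal{A},\mu)$ be a measure space and let $n$ be a positive integer. For $i=1,\dots,n$, let $1<p_i<\infty$ be real numbers such that $p_1^{-1}+\cdots+p_n^{-1}=1$, and let $f_i\in L^{p_i}(\mu)$ satisfy $f_i\ge 0$ and $\|f_i\|_{p_i}>0$. Then $$\left\|\prod_{i=1}^n f_i\right\|_1 \le \prod_{i=1}^n \|f_i\|_{p_i}\left(1-\sum_{i=1}^n \frac{1}{p_i}\left\|\frac{f_i^{p_i/2}}{\|f_i\|_{p_i}^{p_i/2}}-\sum_{k=1}^n \frac{1}{p_k}\frac{f_k^{p_k/2}}{\|f_k\|_{p_k}^{p_k/2}}\right\|_2^2\right).$$
   Context: For $1\le p<\infty$, $\|f\|_p=\left(\int_X |f|^p\,d\mu\right)^{1/p}$ denotes the usual norm on $L^p(\mu)$. The factor $\left(1-\sum_{i=1}^n\cdots\right)$ multiplies the whole product $\prod_{i=1}^n\|f_i\|_{p_i}$; it is not inside the product. *)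

(* Defs.v *)
From HB Require Import structures.
From mathcomp Require Import all_boot all_order all_algebra.
From mathcomp Require Import all_classical all_reals all_analysis.

Set Implicit Arguments.
Unset Strict Implicit.
Unset Printing Implicit Defensive.

Import Order.TTheory GRing.Theory Num.Theory.
Import numFieldNormedType.Exports.

Local Open Scope classical_set_scope.
Local Open Scope ring_scope.

(* f^(p/2) / ||f||_p^(p/2). It is meant for f in L^p(mu), whose norm is finite,
   so that [fine] loses nothing. The value of [powR] at negative reals is a
   convention, which plays no role when f >= 0 mu-almost everywhere. *)
Definition normalized_half_power (d : measure_display) (X : measurableType d)
    (R : realType) (mu : {measure set X -> \bar R}) (p : R) (f : X -> R)
    (x : X) : R :=
  f x `^ (p / 2) / fine ('N[mu]_p%:E[EFin \o f])%E `^ (p / 2).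

(* Main.v *)
(** Put [h_i = f_i ^ (p_i/2) / N_i ^ (p_i/2)] with [N_i = ||f_i||_{p_i}], let
    [w_i = 1/p_i] and [S = \sum_k w_k h_k]. Since each [h_i] has [L^2]-norm 1,
    integrating the variance identity
    [\sum_i w_i (h_i - S)^2 + S^2 = \sum_i w_i h_i^2] shows that the correction
    factor in the statement is exactly the integral of [S^2]. On the other hand
    [\prod_i f_i = \prod_i N_i * (\prod_i h_i ^ w_i)^2] almost everywhere, and
    weighted AM-GM bounds the last square by [S^2]. *)
Require Import Defs.
From HB Require Import structures.
From mathcomp Require Import all_boot all_order all_algebra.
From mathcomp Require Import all_classical all_reals all_analysis.
From mathcomp Require Import measurable_realfun ring.

Set Implicit Arguments.
Unset Strict Implicit.
Unset Printing Implicit Defensive.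

Import Order.TTheory GRing.Theory Num.Theory.
Import numFieldNormedType.Exports.

Local Open Scope classical_set_scope.
Local Open Scope ring_scope.

Section weighted_means.
Context {R : realType} {I : finType}.
Variables (w a : I -> R).
Hypothesis w1 : \sum_i w i = 1.

(** Dividing each [a i] by the weighted mean [A] reduces to mean 1, where the tangent-line bounds
    for the exponential multiply up to [expR 0]. The case [A = 0], where this division makes no
    sense, is treated apart. *)
Lemma weighted_AM_GM : (forall i, 0 < w i) -> (forall i, 0 <= a i) ->
  \prod_i a i `^ w i <= \sum_i w i * a i.
Proof.
move=> w0 a0; set A := \sum_i _.
have wa0 i : 0 <= w i * a i by rewrite mulr_ge0// ltW.
have [A0|A0] := eqVneq A 0.
  (* An index [j] exists because an empty sum of weights would be 0, not 1. Then [a j = 0], and its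
     power with the nonzero exponent [w j] is a zero factor of the product. *)
  have [j _|I0] := pickP (fun _ : I => true); last first.
    by have /eqP[] := oner_neq0 R; rewrite -w1 (big_pred0 _ _ _ _ I0).
  have /psumr_eq0P aj0 := A0.
  have := aj0 (fun i _ => wa0 i) j isT => /eqP; rewrite mulf_eq0 gt_eqF//=.
  by move=> /eqP aj; rewrite A0 (bigD1 j)//= aj powR0 ?gt_eqF// mul0r lexx.
have {}A0 : 0 < A by rewrite lt0r A0 sumr_ge0.
(* Since the weights sum to 1, the powers of [A] multiply to [A] itself. *)
have -> : \prod_i a i `^ w i = (\prod_i (a i / A) `^ w i) * A.
  have -> : \prod_i a i `^ w i = \prod_i ((a i / A) `^ w i * A `^ w i).
    apply: eq_bigr => i _; rewrite -powRM ?divr_ge0 ?(ltW A0)//.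
    by rewrite divfK// gt_eqF.
  rewrite big_split/=; congr (_ * _).
  have -> : \prod_i A `^ w i = expR (\sum_i w i * ln A).
    by rewrite expR_sum; apply: eq_bigr => i _; rewrite /powR gt_eqF.
  by rewrite -mulr_suml w1 mul1r lnK.
rewrite -[leRHS]mul1r ler_wpM2r ?(ltW A0)//.
(* Apply [x <= expR (x - 1)] to [x = a i / A]; the exponents then sum to [0]. *)
apply: (@le_trans _ _ (\prod_i expR (w i * (a i / A - 1)))).
  apply: ler_prod => i _; rewrite powR_ge0/= [X in expR X]mulrC expRM.
  rewrite ge0_ler_powR ?nnegrE ?expR_ge0 ?divr_ge0 ?(ltW (w0 i)) ?(ltW A0)//.
  by rewrite -{1}(subrK 1 (a i / A)) addrC expR_ge1Dx.
rewrite -expR_sum.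
under eq_bigr do rewrite mulrBr mulr1 mulrA.
rewrite sumrB -mulr_suml w1 -/A.
by rewrite divff ?gt_eqF// subrr expR0.
Qed.

Lemma weighted_variance :
  \sum_i w i * (a i - \sum_k w k * a k) ^+ 2 + (\sum_k w k * a k) ^+ 2 =
  \sum_i w i * a i ^+ 2.
Proof.
(* Expansion about an arbitrary centre [s], where the weights summing to 1 give the term [s ^+ 2].
   When [s] is the mean, the cross term becomes [- 2 * s ^+ 2]. *)
have variance s : \sum_i w i * (a i - s) ^+ 2 =
    \sum_i w i * a i ^+ 2 - 2 * s * (\sum_i w i * a i) + s ^+ 2.
  rewrite -[s ^+ 2]mulr1 -[in s ^+ 2 * 1]w1 2!mulr_sumr -sumrB -big_split/=.
  by apply: eq_bigr => i _; ring.
rewrite variance; ring.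
Qed.

End weighted_means.

Section Lnorm_sqr.
Context d {X : measurableType d} {R : realType}.
Variable mu : {measure set X -> \bar R}.
Local Open Scope ereal_scope.

(** Both sides may be [+oo]; there too the natural power of the statement agrees with the real power
    used by [poweR_Lnorm]. *)
Lemma Lnorm2_sqr (g : X -> R) :
  'N[mu]_2%:E[EFin \o g] ^+ 2 = \int[mu]_x ((g x ^+ 2)%R)%:E.
Proof.
have -> : 'N[mu]_2%:E[EFin \o g] ^+ 2 = 'N[mu]_2%:E[EFin \o g] `^ 2.
  have := Lnorm_ge0 mu 2%:E (EFin \o g).
  case: ('N[mu]_2%:E[EFin \o g]) => [r r0||//].
    by rewrite poweR_EFin -EFin_expe powR_mulrn.
  by rewrite poweRyr ?pnatr_eq0.
rewrite poweR_Lnorm ?pnatr_eq0//; apply: eq_integral => x _ /=.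
by rewrite powR_mulrn// real_normK// num_real.
Qed.

Variables (p : R) (f : X -> R).
Hypotheses (p1 : (1 < p)%R) (fL : f \in Lfun mu p%:E).
Hypotheses (f0 : {ae mu, forall x, (0 <= f x)%R}).
Hypotheses (Nf0 : 0 < 'N[mu]_p%:E[EFin \o f]).

Let p0 : (0 < p)%R. Proof. exact: lt_trans p1. Qed.

Let mf : measurable_fun setT f.
Proof. by move: fL => /andP[+ _]; rewrite inE. Qed.

Lemma Lfun_Lnorm_fin_num : 'N[mu]_p%:E[EFin \o f] \is a fin_num.
Proof.
by have /andP[_ /[!inE] fin] := fL; rewrite ge0_fin_numE ?Lnorm_ge0.
Qed.

Let N := fine 'N[mu]_p%:E[EFin \o f].

Let N0 : (0 < N)%R.
Proof. by apply: fine_gt0; rewrite Nf0 ltey_eq Lfun_Lnorm_fin_num. Qed.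

Lemma measurable_normalized_half_power :
  measurable_fun setT (normalized_half_power mu p f).
Proof.
apply: measurable_funM => //.
exact: (measurableT_comp (measurable_powR (p / 2)%R) mf).
Qed.

(** Squaring turns the exponent [p / 2] into [p], so the integrand is almost everywhere
    [|f|^p / N^p], and [|f|^p] integrates to [N^p]. *)
Lemma integral_normalized_half_power_sqr :
  \int[mu]_x ((normalized_half_power mu p f x ^+ 2)%R)%:E = 1.
Proof.
have Np : (0 < N `^ p)%R by exact: powR_gt0.
have mh := measurable_normalized_half_power.
transitivity (\int[mu]_x (((N `^ p)^-1)%:E * (`|f x| `^ p)%:E)).
  (* The two integrands are known to agree only where [f x] is nonnegative. *)
  apply: ge0_ae_eq_integral => //.
  - by apply/measurable_EFinP; exact: measurable_funX.
  - apply/measurable_EFinP; apply: measurable_funM => //.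
    apply: (measurableT_comp (measurable_powR p)).
    exact: measurableT_comp.
  - by move=> x _; rewrite lee_fin sqr_ge0.
  - by move=> x _; rewrite mule_ge0// lee_fin ?invr_ge0 ?powR_ge0.
  apply: filterS f0 => x fx0 _ /=.
  rewrite /normalized_half_power -/N -EFinM ger0_norm//; congr EFin.
  rewrite expr_div_n -!powR_mulrn ?powR_ge0// -!powRrM divfK//.
  by rewrite mulrC.
rewrite ge0_integralZl//; last 2 first.
- apply/measurable_EFinP; apply: (measurableT_comp (measurable_powR p)).
  exact: measurableT_comp.
- by rewrite lee_fin invr_ge0 ltW.
have := poweR_Lnorm mu (EFin \o f) (lt0r_neq0 p0).
rewrite -(fineK Lfun_Lnorm_fin_num) -/N /= => <-.
by rewrite -EFinM mulVf// gt_eqF.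
Qed.

End Lnorm_sqr.

Theorem corollary0p2 (R : realType) (d : measure_display)
    (X : measurableType d) (mu : {measure set X -> \bar R}) (n : nat)
    (p : 'I_n -> R) (f : 'I_n -> X -> R) :
  (0 < n)%N ->
  (forall i, 1 < p i) ->
  \sum_(i < n) (p i)^-1 = 1 ->
  (forall i, f i \in Lfun mu (p i)%:E) ->
  (forall i, {ae mu, forall x, 0 <= f i x}) ->
  (forall i, 0 < 'N[mu]_(p i)%:E[EFin \o f i])%E ->
  ('N[mu]_1[EFin \o (fun x => (\prod_(i < n) f i x)%R)]
   <= (\prod_(i < n) 'N[mu]_(p i)%:E[EFin \o f i]) *
      (1 - \sum_(i < n) (p i)^-1%:E *
         'N[mu]_2%:E[EFin \o (fun x =>
            (normalized_half_power mu (p i) (f i) x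
             - \sum_(k < n)
                 (p k)^-1 * normalized_half_power mu (p k) (f k) x)%R)]
         ^+ 2))%E.
Proof.
move=> _ p1 wsum fL f0 Nf0.
have w0 i : 0 < (p i)^-1 by rewrite invr_gt0 (lt_trans _ (p1 i)).
pose h i := normalized_half_power mu (p i) (f i).
pose S x := \sum_(k < n) (p k)^-1 * h k x.
pose N i := fine ('N[mu]_(p i)%:E[EFin \o f i])%E.
have NE i : ('N[mu]_(p i)%:E[EFin \o f i] = (N i)%:E)%E.
  by rewrite fineK// Lfun_Lnorm_fin_num.
have N0 i : 0 < N i by rewrite -lte_fin -NE.
have mf i : measurable_fun setT (f i) by case/andP: (fL i); rewrite inE.
have mh i : measurable_fun setT (h i).
  exact: measurable_normalized_half_power (fL i).
have h0 i x : 0 <= h i x by rewrite divr_ge0 ?powR_ge0.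
have mS : measurable_fun setT S.
  by apply: measurable_sum => i; exact: measurable_funM.
have S0 x : 0 <= S x by apply: sumr_ge0 => i _; rewrite mulr_ge0// ltW.
(* The integrated variance identity is stated as a sum, so that nothing is subtracted in [\bar R]
   before finiteness is known. All terms are nonnegative, which lets sums and integrals be
   exchanged. *)
have var : (\sum_(i < n) (p i)^-1%:E *
    'N[mu]_2%:E[EFin \o (fun x => h i x - S x)%R] ^+ 2 +
    \int[mu]_x (S x ^+ 2)%:E = 1)%E.
  have mD i : measurable_fun setT
      (fun x => ((p i)^-1%:E * ((h i x - S x) ^+ 2)%:E)%E).
    apply/measurable_EFinP; apply: measurable_funM => //.
    by apply: measurable_funX; exact: measurable_funB.
  transitivity (\int[mu]_x (\sum_(i < n) (p i)^-1%:E * (h i x ^+ 2)%:E))%E.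
    under eq_bigr.
      move=> i _; rewrite Lnorm2_sqr -ge0_integralZl//.
      - over.
      - by apply/measurable_EFinP; apply: measurable_funX;
           exact: measurable_funB.
      - by move=> x _; rewrite lee_fin sqr_ge0.
      - by rewrite lee_fin ltW.
    have D0 i x : (0 <= (p i)^-1%:E * ((h i x - S x) ^+ 2)%:E)%E.
      by rewrite lee_fin mulr_ge0 ?sqr_ge0 ?ltW.
    rewrite -ge0_integral_sum//= -ge0_integralD//; last 4 first.
    - by move=> x _; apply: sume_ge0.
    - exact: emeasurable_sum.
    - by move=> x _; rewrite lee_fin sqr_ge0.
    - by apply/measurable_EFinP; exact: measurable_funX.
    apply: eq_integral => x _.
    by rewrite !sumEFin -EFinD (weighted_variance (fun i => h i x) wsum).
  rewrite ge0_integral_sum//.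
  - transitivity (\sum_(i < n) ((p i)^-1)%:E)%E; last by rewrite sumEFin wsum.
    apply: eq_bigr => i _; rewrite ge0_integralZl//.
    + by rewrite integral_normalized_half_power_sqr// mule1.
    + by apply/measurable_EFinP; exact: measurable_funX.
    + by move=> x _; rewrite lee_fin sqr_ge0.
    + by rewrite lee_fin ltW.
  - move=> i; apply/measurable_EFinP; apply: measurable_funM => //.
    exact: measurable_funX.
  - by move=> i x _; rewrite lee_fin mulr_ge0 ?sqr_ge0 ?ltW.
have -> : (1 - \sum_(i < n) (p i)^-1%:E *
    'N[mu]_2%:E[EFin \o (fun x => h i x - S x)%R] ^+ 2 =
    \int[mu]_x (S x ^+ 2)%:E)%E.
  (* Cancelling the correction sum requires it to be finite; [var] itself bounds it by 1. *)
  rewrite -[X in (X - _)%E]var addeAC subee ?add0e//.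
  rewrite ge0_fin_numE; last first.
    apply: sume_ge0 => i _; rewrite mule_ge0 ?lee_fin ?(ltW (w0 i))//.
    by rewrite expe_ge0 ?Lnorm_ge0.
  apply: (@le_lt_trans _ _ 1%E); last exact: ltry.
  by rewrite -[leRHS]var leeDl// integral_ge0// => x _; rewrite lee_fin sqr_ge0.
under eq_bigr do rewrite NE.
rewrite prodEFin Lnorm1 -ge0_integralZl//=; last 3 first.
- by apply/measurable_EFinP; exact: measurable_funX.
- by move=> x _; rewrite lee_fin sqr_ge0.
- by rewrite lee_fin prodr_ge0// => i _; rewrite ltW.
apply: ae_ge0_le_integral => //.
- apply/measurable_EFinP; apply: measurableT_comp => //.
  by apply: measurable_prod => i _; exact: mf.
- move=> x _; rewrite lee_fin mulr_ge0 ?sqr_ge0// prodr_ge0// => i _.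
  by rewrite ltW.
- apply/measurable_EFinP; apply: measurable_funM => //.
  exact: measurable_funX.
(* Finitely many almost-everywhere conditions are merged, leaving a pointwise inequality where all
   [f i x] are nonnegative. *)
have {}f0 : {ae mu, forall x, forall i, 0 <= f i x} by exact: filter_forall.
apply: filterS f0 => x f0 _.
have -> : \prod_(i < n) f i x =
    (\prod_(i < n) N i) * (\prod_(i < n) h i x `^ (p i)^-1) ^+ 2.
  rewrite -prodrXl -big_split/=; apply: eq_bigr => i _.
  have pi0 : p i != 0 by rewrite gt_eqF// (lt_trans _ (p1 i)).
  rewrite /h /normalized_half_power -/(N i) -powR_mulrn ?powR_ge0//.
  (* Written as one power of [f i x / N i], the half power is undone by the exponent
     [(p i)^-1 * 2]. *)
  have -> : f i x `^ (p i / 2) / N i `^ (p i / 2) = (f i x / N i) `^ (p i / 2).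
    have {1}-> : f i x = (f i x / N i) * N i by rewrite divfK// gt_eqF.
    rewrite powRM ?divr_ge0 ?(ltW (N0 i))// mulfK//.
    by rewrite gt_eqF// powR_gt0.
  rewrite -!powRrM.
  have -> : p i / 2 * ((p i)^-1 * 2) = 1 by field.
  rewrite powRr1 ?divr_ge0 ?(ltW (N0 i))//.
  by rewrite [RHS]mulrC divfK// gt_eqF.
have P0 : 0 <= \prod_(i < n) h i x `^ (p i)^-1.
  by apply: prodr_ge0 => i _; exact: powR_ge0.
have Npos : 0 <= \prod_(i < n) N i by apply: prodr_ge0 => i _; exact: ltW.
rewrite -EFinM lee_fin ger0_norm ?mulr_ge0 ?sqr_ge0//.
(* Cancelling the product of the norms and then the squares leaves AM-GM for the [h i x]. *)
rewrite ler_wpM2l// lerXn2r ?nnegrE//.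
exact: weighted_AM_GM.
Qed.
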